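(* Let $\alpha,a\in\mathbb{R}$. For every integer $\nu\ge 0$, $Q_\nu^{(\alpha,-a)}(x)$ is a polynomial of degree $\nu$ that satisfies the recursive differential relation $$Q_{\nu+1}^{(\alpha,-a)}(x)=\sigma(x)\frac{dQ_{\nu}^{(\alpha,-a)}(x)}{dx}+[\tau(x)+2x(l-\nu-1)]\,Q_{\nu}^{(\alpha,-a)}(x)=\sigma(x)\frac{dQ_{\nu}^{(\alpha,-a)}(x)}{dx}+[\alpha-2x(a+\nu+1)]\,Q_{\nu}^{(\alpha,-a)}(x),\qquad \nu=0,1,\ldots,$$ where $\tau(x)=\alpha-\sigma'(x)(a+l)=\alpha-2x(a+l)$.
   Context: Throughout $x$ is a real variable, $\alpha,a$ are real parameters, $\sigma(x)=1+x^2$, and $\cot^{-1}:\mathbb{R}\to(0,\pi)$ is the smooth branch, so that $\frac{d}{dx}\cot^{-1}x=-1/\sigma(x)$. For integers $l\ge 0$ put $w_l(x)=\sigma(x)^{-(l+a+1)}e^{-\alpha\cot^{-1}x}=\sigma(x)^{-l}w_0(x)$. Define $P_l^{(a,\alpha)}(x)=\frac{1}{w_l(x)}\frac{d^l}{dx^l}[w_l(x)\sigma(x)^l]=\frac{\sigma(x)^l}{w_0(x)}\frac{d^l w_0(x)}{dx^l}$. The complementary (Romanovski) polynomials $Q_\nu^{(\alpha,-a)}$, with $Q_0^{(\alpha,-a)}\equiv 1$, are defined inductively by the Rodrigues representation $P_l^{(a,\alpha)}(x)=\frac{1}{w_l(x)}\frac{d^{l-\nu}}{dx^{l-\nu}}[\sigma(x)^{l-\nu}w_l(x)Q_\nu^{(\alpha,-a)}(x)]$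 for $\nu=0,1,\ldots,l$ (the case $l=\nu$ reads $Q_\nu^{(\alpha,-a)}=P_\nu^{(a,\alpha)}$); they do not depend on $l$. The integer $l\ge\nu$ in the first form of the relation is the index of the weight $w_l$; it cancels in the second form. The second upper index of $Q_\nu^{(\alpha,-a)}$ is minus the parameter $a$ of the weight.
   Formalization: The degree of Q_ν is shown to be at most ν for all real α, a, and exactly ν when 2a+2+k ≠ 0 for all 0 ≤ k < ν; without this condition the degree claim is false (for a = −1, Q_1 is the constant α). *)

(* Defs.v *)
From HB Require Import structures.
From mathcomp Require Import all_boot all_order all_algebra.
From mathcomp Require Import all_classical all_reals all_analysis.
From mathcomp Require Import ring.
Import Order.TTheory GRing.Theory Num.Theory.
Import numFieldNormedType.Exports.

Set Implicit Arguments.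
Unset Strict Implicit.
Unset Printing Implicit Defensive.

Local Open Scope classical_set_scope.
Local Open Scope ring_scope.

Definition sigma {R : realType} (x : R) : R := 1 + x ^+ 2.

(* The smooth branch of the inverse cotangent, with values in ]0, pi[; see
   [acot_itv], [acotK] and [is_derive1_acot]. *)
Definition acot {R : realType} (x : R) : R := pi / 2 - atan x.

Definition weight {R : realType} (alpha a : R) (l : nat) (x : R) : R :=
  sigma x `^ (- (l%:R + a + 1)) * expR (- alpha * acot x).

(* P_l^(a,alpha) *)
Definition Romanovski {R : realType} (alpha a : R) (l : nat) (x : R) : R :=
  (weight alpha a l x)^-1 *
  derive1n l (fun y => weight alpha a l y * sigma y ^+ l) x.

(* [complementary alpha a Q] says that [Q nu] is Q_nu^(alpha,-a) for all nu.
   [a] is the parameter of the weight; the second upper index of Q_nu is its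
   opposite.  The family is determined by the instances nu = l and it exists:
   see [complementary_unique] and [complementary_exists]. *)
Definition complementary {R : realType} (alpha a : R) (Q : nat -> R -> R) : Prop :=
  (forall x, Q 0%N x = 1) /\
  (forall l nu : nat, (nu <= l)%N -> forall x,
     Romanovski alpha a l x =
     (weight alpha a l x)^-1 *
     derive1n (l - nu)
       (fun y => sigma y ^+ (l - nu) * weight alpha a l y * Q nu y) x).

Definition tau {R : realType} (alpha a : R) (l : nat) (x : R) : R :=
  alpha - derive1 sigma x * (a + l%:R).

(* The coefficient of x^nu in Q_nu^(alpha,-a) is
   (-1)^nu * \prod_(k < nu) (2 * a + 2 + k), so this says that it is nonzero.
   It can fail only when 2 * a is an integer <= -2: for a = -1, Q_1 is the
   constant alpha. *)
Definition nonzero_lead {R : realType} (a : R) (nu : nat) : Prop :=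
  forall k : nat, (k < nu)%N -> 2 * a + 2 + k%:R != 0.

Section Facts.
Context {R : realType}.
Implicit Types (alpha a x : R) (l nu : nat).

Lemma acot_itv x : 0 < acot x < pi.
Proof.
rewrite /acot subr_gt0 atan_ltpi2 /= ltrBlDr -ltrBlDl.
have -> : pi / 2 - pi = - (pi / 2) :> R by rewrite {2}[pi]splitr opprD addNKr.
exact: atan_gtNpi2.
Qed.

Lemma acotK x : cos (acot x) / sin (acot x) = x.
Proof.
rewrite /acot [pi / 2 - _]addrC cosDpihalf sinDpihalf sinN cosN opprK.
exact: atanK.
Qed.

Lemma is_derive1_acot x : is_derive x 1 acot (- (sigma x)^-1).
Proof.
rewrite -[- _]add0r.
have -> : acot = cst (pi / 2) - @atan R by apply/funext.
exact: is_deriveB.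
Qed.

Lemma sigma_gt0 x : 0 < sigma x.
Proof. by rewrite /sigma ltr_wpDr // sqr_ge0. Qed.

Lemma weight_gt0 alpha a l x : 0 < weight alpha a l x.
Proof. by rewrite mulr_gt0 ?expR_gt0 // powR_gt0 // sigma_gt0. Qed.

Lemma weightE alpha a l x : weight alpha a l x * sigma x ^+ l = weight alpha a 0 x.
Proof.
rewrite /weight mulrAC -powR_mulrn ?ltW ?sigma_gt0 // -powRD.
  by congr (_ `^ _ * _); ring.
by apply/implyP => _; rewrite gt_eqF ?sigma_gt0.
Qed.

Lemma RomanovskiE alpha a l x :
  Romanovski alpha a l x =
  sigma x ^+ l / weight alpha a 0 x * derive1n l (weight alpha a 0) x.
Proof.
rewrite /Romanovski.
have -> : (fun y => weight alpha a l y * sigma y ^+ l) = weight alpha a 0.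
  by apply/funext => y; rewrite weightE.
congr (_ * _); rewrite -(weightE alpha a l) [in RHS]invfM mulrCA divff ?mulr1 //.
by rewrite expf_neq0 // gt_eqF ?sigma_gt0.
Qed.

Lemma complementary_exists alpha a : complementary alpha a (Romanovski alpha a).
Proof.
split=> [x|l nu lenul x].
  by rewrite /Romanovski /= expr0 mulr1 mulVf // gt_eqF ?weight_gt0.
rewrite {1}/Romanovski; congr (_ * _).
have -> : (fun y => weight alpha a l y * sigma y ^+ l) = weight alpha a 0.
  by apply/funext => y; rewrite weightE.
rewrite -{1}(subnK lenul) /derive1n iterD; congr (iter _ _ _ _).
apply/funext => y; rewrite RomanovskiE /derive1n.
have w0 : weight alpha a 0 y != 0 by rewrite gt_eqF ?weight_gt0.
set d := iter _ _ _ _.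
transitivity (weight alpha a l y * (sigma y ^+ (l - nu) * sigma y ^+ nu)
    / weight alpha a 0 y * d); last by ring.
by rewrite -exprD subnK // weightE divff // mul1r.
Qed.

Lemma complementary_unique alpha a (Q : nat -> R -> R) :
  complementary alpha a Q -> Q = Romanovski alpha a.
Proof.
move=> [_ hQ]; apply/funext => nu; apply/funext => x.
rewrite (hQ nu nu) // subnn /= expr0 mul1r mulKf //.
by rewrite gt_eqF ?weight_gt0.
Qed.

End Facts.

(* Main.v *)
Require Import Defs.
From HB Require Import structures.
From mathcomp Require Import all_boot all_order all_algebra.
From mathcomp Require Import all_classical all_reals all_analysis.
From mathcomp Require Import ring.
Import Order.TTheory GRing.Theory Num.Theory.
Import numFieldNormedType.Exports.

(** The point is that differentiating the weight raises its index and costs only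
an affine factor: w_n' = w_(n+1) (alpha - 2 (a + n + 1) x) ([is_derive_weight]).
Hence, if the n-th derivative of w_0 is w_n times a polynomial p_n, the product
rule and w_n = sigma w_(n+1) show that the next one is w_(n+1) times
    p_(n+1) = sigma p_n' + (alpha - 2 (a + n + 1) x) p_n,
which is the announced recursion. The polynomials [comp_poly] are defined by it,
and [derive1n_weight] is the resulting Rodrigues formula. Since
P_n = sigma^n w_0^(n) / w_0 and w_n sigma^n = w_0, the formula says P_n = p_n;
and the only complementary family is Q_n = P_n ([complementary_unique]).

For the degree, the recursion raises the size by at most one, and the
coefficient of x^(n+1) in p_(n+1) collects n from sigma p_n' and
- 2 (a + n + 1) from the other term, so each step multiplies the top coefficient
by - (2 a + 2 + n) ([coef_comp_polyS]). Since sigma' = 2 x, the index l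
cancels in tau + 2 x (l - n - 1), so both forms of the affine factor agree. *)

Set Implicit Arguments.
Unset Strict Implicit.
Unset Printing Implicit Defensive.

Local Open Scope classical_set_scope.
Local Open Scope ring_scope.

Section Complementary.
Context {R : realType}.
Implicit Types (alpha a x : R) (n : nat).

Lemma is_derive_sigma x : is_derive x 1 (@sigma R) (2 * x).
Proof.
have -> : @sigma R = horner (1 + 'X^2).
  by apply/funext => y; rewrite /sigma !hornerE.
by apply: is_derive_eq; rewrite derivD derivC derivXn !hornerE; ring.
Qed.

Lemma tauE alpha a n x : tau alpha a n x = alpha - 2 * x * (a + n%:R).
Proof.
by rewrite /tau derive1E; have /@derive_val -> := is_derive_sigma x.
Qed.

Lemma weightS alpha a n x :
  weight alpha a n x = sigma x * weight alpha a n.+1 x.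
Proof.
have s0 := sigma_gt0 x.
rewrite /weight mulrA -{2}[sigma x]powRr1 ?ltW // -powRD.
  by congr (_ `^ _ * _); ring.
by apply/implyP => _; rewrite gt_eqF.
Qed.

(** Both factors contribute the same power of sigma: the power rule lowers the
exponent by one, and the derivative of [acot] is - 1 / sigma. *)
Lemma is_derive_weight alpha a n x :
  is_derive x 1 (weight alpha a n)
    (weight alpha a n.+1 x * (alpha - 2 * x * (a + n%:R + 1))).
Proof.
have s0 := sigma_gt0 x.
have dp : is_derive x 1 ((@powR R) ^~ (- (n%:R + a + 1)) \o @sigma R)
    (- (n%:R + a + 1) * sigma x `^ (- (n%:R + a + 1) - 1) * (2 * x)).
  by apply: is_derive1_comp; [exact: is_derive1_powR|exact: is_derive_sigma].
have de : is_derive x 1 (@expR R \o (- alpha *: @acot R))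
    (expR (- alpha * acot x) * (- alpha *: - (sigma x)^-1)).
  apply: is_derive1_comp; apply: is_deriveZ; exact: is_derive1_acot.
apply: (is_derive_eq (is_deriveM dp de : is_derive x 1 (weight alpha a n) _)).
have -> : - (n%:R + a + 1) - 1 = - (n.+1%:R + a + 1) by ring.
rewrite /= -![_ *: _]/(_ * _).
(* Cancelling the exponential in weightS expresses sigma^-(n + a + 1) by the
   next power, the only one left after the product rule. *)
have := weightS alpha a n x; rewrite /weight mulrA => /mulIf -> //.
  by field; rewrite gt_eqF.
by rewrite gt_eqF ?expR_gt0.
Qed.

(** The terms p^`() and p^`() * 'X^2 together are sigma p'. *)
Fixpoint comp_poly alpha a n : {poly R} :=
  if n is m.+1 then
    let p := comp_poly alpha a m in
    p^`() + p^`() * 'X^2 + alpha *: p - (2 * (a + m%:R + 1)) *: (p * 'X)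
  else 1.

Lemma comp_polyS alpha a n x :
  (comp_poly alpha a n.+1).[x] =
  sigma x * (comp_poly alpha a n)^`().[x] +
  (alpha - 2 * x * (a + n%:R + 1)) * (comp_poly alpha a n).[x].
Proof.
rewrite /= !(hornerD, hornerN, hornerZ, hornerM, hornerX, hornerXn) /sigma.
by ring.
Qed.

Lemma derive1n_weight alpha a n :
  derive1n n (weight alpha a 0) =
  (fun x => weight alpha a n x * (comp_poly alpha a n).[x]).
Proof.
elim: n => [|n IHn]; first by apply/funext => x; rewrite /= hornerC mulr1.
rewrite derive1nS IHn; apply/funext => x; rewrite derive1E.
have := is_deriveM (is_derive_weight alpha a n x)
                   (is_derive_poly (comp_poly alpha a n) x).
move=> /@derive_val; rewrite -![_ *: _]/(_ * _) => ->.
by rewrite comp_polyS weightS; ring.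
Qed.

Lemma Romanovski_poly alpha a n x :
  Romanovski alpha a n x = (comp_poly alpha a n).[x].
Proof.
have w0 : weight alpha a n x != 0 by rewrite gt_eqF ?weight_gt0.
have s0 : sigma x ^+ n != 0 by rewrite expf_neq0 // gt_eqF ?sigma_gt0.
rewrite RomanovskiE derive1n_weight -(weightE alpha a n).
by rewrite [X in _ / X]mulrC invfM mulVKf // mulKf.
Qed.

Lemma size_comp_poly alpha a n : (size (comp_poly alpha a n) <= n.+1)%N.
Proof.
elim: n => [|n IHn]; first by rewrite size_poly1.
apply/leq_sizeP => -[|[|j]] // ltnj.
have c0 k : (comp_poly alpha a n)`_(k + j.+1) = 0.
  by apply: (leq_sizeP _ _ IHn); apply: leq_trans (leq_addl _ _).
rewrite /= !(coefB, coefD, coef_deriv, coefMXn, coefZ, coefMX) /= subn2 /=.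
by rewrite (c0 0) (c0 1) (c0 2) !(mul0rn, mulr0, addr0, subr0).
Qed.

Lemma coef_comp_polyS alpha a n :
  (comp_poly alpha a n.+1)`_n.+1 =
  - (2 * a + 2 + n%:R) * (comp_poly alpha a n)`_n.
Proof.
have c0 k : (comp_poly alpha a n)`_(k + n.+1) = 0.
  by apply: (leq_sizeP _ _ (size_comp_poly alpha a n)); apply: leq_addl.
rewrite /= !(coefB, coefD, coef_deriv, coefMXn, coefZ, coefMX) /= (c0 0) (c0 1).
(* The term p^`() * 'X^2 contributes only in degree at least 2, hence the case
   n = 0; there the factor n it would bring vanishes anyway. *)
by case: n {c0} => [|n] /=; rewrite ?subn2 /=; ring.
Qed.

Lemma size_comp_poly_eq alpha a n :
  nonzero_lead a n -> size (comp_poly alpha a n) = n.+1.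
Proof.
move=> nz; apply/eqP; rewrite eqn_leq size_comp_poly /=.
suff : (comp_poly alpha a n)`_n != 0.
  by apply: contraR; rewrite -leqNgt => /leq_sizeP ->.
elim: n nz => [|n IHn] nz; first by rewrite coef1 oner_neq0.
rewrite coef_comp_polyS mulf_neq0 ?oppr_eq0 ?nz // IHn // => k ltkn.
exact/nz/leqW.
Qed.

End Complementary.

Theorem theorem1p1 (R : realType) (alpha a : R) (Q : nat -> R -> R)
    (hQ : complementary alpha a Q) (nu : nat) :
  (exists q : {poly R},
     [/\ forall x, Q nu x = q.[x],
         (size q <= nu.+1)%N
       & nonzero_lead a nu -> size q = nu.+1]) /\
  (forall l : nat, (nu <= l)%N -> forall x : R,
     [/\ Q nu.+1 x = sigma x * derive1 (Q nu) x
           + (tau alpha a l x + 2 * x * (l%:R - nu%:R - 1)) * Q nu x,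
         Q nu.+1 x = sigma x * derive1 (Q nu) x
           + (alpha - 2 * x * (a + nu%:R + 1)) * Q nu x
       & tau alpha a l x = alpha - 2 * x * (a + l%:R)]).
Proof.
have QE n : Q n = horner (comp_poly alpha a n).
  by rewrite (complementary_unique hQ); apply/funext => x; exact: Romanovski_poly.
split.
  exists (comp_poly alpha a nu); split => [x||]; first by rewrite QE.
    exact: size_comp_poly.
  exact: size_comp_poly_eq.
move=> l _ x; rewrite tauE !QE comp_polyS -derivE.
by split=> //; congr (_ + _ * _); ring.
Qed.
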